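(* Let $G=(V,E)$ be a simple digraph with $V=\{v_1,v_2,\ldots,v_n\}$. Then $G$ is a central interval catch digraph if and only if there exists an injective labeling $f:V\to\mathbb{R}^+$ of the vertices such that, writing $d(i,j)=|f(v_i)-f(v_j)|$, $$d(i,j)<d(i,k)\quad\text{for all } i,j,k\in\{1,2,\ldots,n\} \text{ with } k\neq i,\ v_iv_j\in E \text{ and } v_iv_k\notin E.$$
   Context: Digraphs are finite and simple (no loops, no multiple arcs; both $uv$ and $vu$ may be arcs). $\mathbb{R}^+$ is the set of positive real numbers. A digraph $G=(V,E)$ is a central interval catch digraph (central ICD) if one can assign to each $u\in V$ a closed bounded interval $I_u$ of the real line with center (midpoint) $c_u$ such that for $u,v\in V$: $uv\in E$ if and only if $u\neq v$ and $c_v\in I_u$. *)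

(* Defs.v *)
From mathcomp Require Import all_boot all_order all_algebra.
From mathcomp Require Import reals.
Set Implicit Arguments.
Unset Strict Implicit.
Unset Printing Implicit Defensive.
Import Order.TTheory GRing.Theory Num.Theory.
Local Open Scope ring_scope.

(* A simple digraph on V is its arc relation: multiple arcs are impossible,
   and only loops have to be excluded. *)
Definition simple_digraph (V : finType) (E : rel V) : Prop := irreflexive E.

(* Degenerate intervals (single points) are allowed, empty ones are not. *)
Definition closed_bounded_itv (R : realType) (I : interval R) : Prop :=
  exists a b : R, a <= b /\ I = `[a, b].

Definition central_ICD (R : realType) (V : finType) (E : rel V) : Prop :=
  exists I : V -> interval R,
    (forall u, closed_bounded_itv (I u)) /\
    (forall u v : V, E u v <-> u <> v /\ miditv (I v) \in I u).

(* Main.v *)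
(* If the interval of [u] has center [c u] and radius [r u], then [u -> w] iff
   [w <> u] and [`|c u - c w| <= r u], so out-neighbours are strictly closer to
   [c u] than non-neighbours.  Centers may coincide, but finitely many strict
   comparisons of distances survive a small perturbation, which is used to
   separate them.  Conversely, the interval centered at [f u] that reaches
   exactly to the farthest out-neighbour of [u] represents the digraph. *)
Require Import Defs.
From mathcomp Require Import all_boot all_order all_algebra.
From mathcomp Require Import reals.
From mathcomp Require Import ring lra.
Set Implicit Arguments.
Unset Strict Implicit.
Unset Printing Implicit Defensive.
Import Order.TTheory GRing.Theory Num.Theory.
Local Open Scope ring_scope.

Lemma fin_pos_lower_bound (R : realDomainType) (T : finType) (P : pred T)
    (g : T -> R) :
  (forall t, P t -> 0 < g t) ->
  exists2 d : R, 0 < d & forall t, P t -> d <= g t.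
Proof.
move=> g_gt0; exists (\big[Num.min/1]_(t | P t) g t).
  by apply: lt_bigmin.
by move=> t Pt; apply: bigmin_le_cond.
Qed.

(** Distinct offsets in [[0, d/4)], with [d] a lower bound on the gaps of all strict comparisons,
    change each distance by less than [d/4], so no strict comparison is lost. *)
Lemma perturb_injective (R : realFieldType) (V : finType) (c : V -> R) :
  exists f : V -> R,
    [/\ forall u, 0 < f u,
        injective f
      & forall x y z, `|c x - c y| < `|c x - c z| ->
          `|f x - f y| < `|f x - f z| ].
Proof.
pose P (t : V * V * V) := `|c t.1.1 - c t.1.2| < `|c t.1.1 - c t.2|.
pose g (t : V * V * V) := `|c t.1.1 - c t.2| - `|c t.1.1 - c t.1.2|.
have [d d_gt0 d_le] : exists2 d : R, 0 < d & forall t, P t -> d <= g t.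
  by apply: fin_pos_lower_bound => t Pt; rewrite subr_gt0.
(* The successor keeps the denominator nonzero when [V] is empty. *)
pose e := d / (4 * (#|V|.+1%:R)).
have N_gt0 : 0 < #|V|.+1%:R :> R by rewrite ltr0n.
have e_gt0 : 0 < e by rewrite divr_gt0 // mulr_gt0 // ltr0n.
pose p (u : V) := e * (enum_rank u)%:R.
have p_ge0 u : 0 <= p u by rewrite mulr_ge0 ?ler0n // ltW.
have p_lt u : p u < d / 4.
  have -> : d / 4 = e * #|V|.+1%:R.
    by rewrite /e; field; rewrite addrC natr1 pnatr_eq0.
  by rewrite ltr_pM2l // ltr_nat ltnS ltnW // ltn_ord.
have p_dist u w : `|p u - p w| < d / 4.
  have := p_ge0 u; have := p_ge0 w; have := p_lt u; have := p_lt w.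
  by rewrite ltr_norml => *; apply/andP; split; lra.
(* A translation that makes all labels positive and keeps distances. *)
pose M := 1 + \sum_u `|c u|.
pose f u := c u + p u + M.
have f_sub x y : f x - f y = (c x - c y) + (p x - p y) by rewrite /f; ring.
have f_lt x y z : `|c x - c y| < `|c x - c z| -> `|f x - f y| < `|f x - f z|.
  move=> lt_xyz; have := d_le (x, y, z) lt_xyz; rewrite /g /= => gap.
  have := p_dist x y; have := p_dist x z.
  have := ler_normD (c x - c y) (p x - p y).
  have := lerB_normD (c x - c z) (p x - p z).
  by rewrite !f_sub; lra.
exists f; split=> //.
  move=> u; rewrite /f /M (bigD1 u) //=.
  have : 0 <= \sum_(i | i != u) `|c i| by apply: sumr_ge0.
  by have := p_ge0 u; have := ler_norm (- c u); rewrite normrN; lra.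
move=> x y fxy; have [cxy|cxy] := eqVneq (c x) (c y).
  have : p x = p y by move: fxy; rewrite /f cxy; lra.
  move/(mulfI (lt0r_neq0 e_gt0))/eqP.
  by rewrite eqr_nat => /eqP/ord_inj/enum_rank_inj.
(* Distinct centers stay apart: [0 < |c x - c y|] is itself a preserved comparison. *)
have := f_lt x x y; rewrite fxy !subrr normr0 normr_gt0 subr_eq0 => /(_ cxy).
by rewrite ltxx.
Qed.

Lemma central_ICD_radiusP (R : realType) (V : finType) (E : rel V) :
  central_ICD R E <->
  exists c r : V -> R,
    (forall u, 0 <= r u) /\
    (forall u w, E u w <-> u <> w /\ `|c u - c w| <= r u).
Proof.
split=> [[I [I_itv IE]]|[c [r [r_ge0 crE]]]].
- exists (fun u => miditv (I u)).
  have /fin_all_exists [r rP] (u : V) : exists r : R,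
      0 <= r /\ forall x, (x \in I u) = (`|miditv (I u) - x| <= r).
    have [a [b [ab ->]]] := I_itv u.
    exists ((b - a) / 2); split=> [|x]; first by lra.
    by rewrite in_itv /= ler_norml; apply/andP/andP => -[? ?]; split; lra.
  exists r; split=> [u|u w]; first by case: (rP u).
  by rewrite IE; case: (rP u) => _ ->.
- exists (fun u => `[c u - r u, c u + r u]); split=> [u|u w].
    by exists (c u - r u), (c u + r u); split=> //; have := r_ge0 u; lra.
  rewrite crE.
  have -> : miditv `[c w - r w, c w + r w] = c w by rewrite /=; field.
  suff -> : (c w \in `[c u - r u, c u + r u]) = (`|c u - c w| <= r u) by [].
  by rewrite in_itv /= ler_norml; apply/andP/andP => -[? ?]; split; lra.
Qed.

Theorem theorem5p3 (R : realType) (V : finType) (E : rel V)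
    (hE : simple_digraph E) (n : nat) (v : 'I_n -> V) (hv : bijective v) :
  central_ICD R E <->
  exists f : V -> R,
    [/\ forall u : V, 0 < f u,
        injective f
      & forall i j k : 'I_n, k <> i -> E (v i) (v j) -> ~ E (v i) (v k) ->
          `|f (v i) - f (v j)| < `|f (v i) - f (v k)| ].
Proof.
rewrite central_ICD_radiusP; split=> [[c [r [r_ge0 crE]]]|[f [_ f_inj f_lt]]].
- have [f [f_gt0 f_inj f_lt]] := perturb_injective c.
  exists f; split=> // i j k ki Eij nEik; apply: f_lt.
  have [_ cij] := (crE _ _).1 Eij; apply: le_lt_trans cij _.
  rewrite ltNge; apply/negP => cik; apply/nEik/crE; split=> //.
  by move/(bij_inj hv)/esym.
(* Surjectivity of [v] carries the condition from indices to vertices. *)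
- have {}f_lt x y z : z <> x -> E x y -> ~ E x z ->
      `|f x - f y| < `|f x - f z|.
    case: hv => w _ vw; rewrite -[x]vw -[y]vw -[z]vw => zx.
    by apply: f_lt => wzx; apply: zx; rewrite wzx.
  (* The default [0] gives a vertex without out-neighbours a one-point interval. *)
  exists f, (fun u => \big[Num.max/0]_(w | E u w) `|f u - f w|).
  split=> [u|u w]; first exact: bigmax_ge_id.
  split=> [Euw|[uw le_uw]].
    split; first by move=> uw; move: Euw; rewrite uw hE.
    exact: le_bigmax_cond.
  apply: contraT => /negP nEuw; move: le_uw; rewrite leNgt => /negP[].
  (* A non-neighbour [w] lies beyond the radius: injectivity of [f] beats the default [0], and
     [f_lt] beats each out-neighbour. *)
  apply: bigmax_lt => [|y Euy].
    by rewrite normr_gt0 subr_eq0; apply/eqP => /f_inj.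
  by apply: f_lt => // /esym.
Qed.
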